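(* The left Bregman farthest-distance function $\overleftarrow{F}_C$ is continuous on $U$ and it can be written as the composition $$\overleftarrow{F}_C=\big(f^*+(-f^\vee+\iota_{-C})^*\big)\circ\nabla f,$$ where $f^*+(-f^\vee+\iota_{-C})^*$ is locally Lipschitz (on $\mathbb{R}^J$) and $\nabla f$ is continuous (on $U$). Consequently, $\overleftarrow{F}_C$ is locally Lipschitz on $U$ provided that $\nabla f$ is locally Lipschitz on $U$, as is the case when $f$ is twice continuously differentiable on $U$. Finally, $$(-f^\vee+\iota_{-C})^*=\overleftarrow{F}_C\circ\nabla f^*-f^*,$$ and hence $\overleftarrow{F}_C\circ\nabla f^*$ is a locally Lipschitz convex function with full domain.
   Context: $\mathbb{R}^J$ is the standard Euclidean space with inner product $\langle\cdot,\cdot\rangle$ and norm $\|\cdot\|$. Standing assumptions: (1) $f\colon\mathbb{R}^J\to\,]-\infty,+\infty]$ is a convex function of Legendre type, i.e., $f$ is proper, lower semicontinuous, convex, essentially smooth (with $U:=\operatorname{int}\operatorname{dom} f\neq\varnothing$, $f$ is differentiable on $U$ and $\|\nabla f(x_n)\|\to+\infty$ whenever $(x_n)$ is a sequence in $U$ converging to a boundary point of $U$) and essentially strictly convex ($f$ is strictly convex on every convex subset of $\operatorname{dom}\partial f$). (2) $f$ is $1$-coercive: $\lim_{\|x\|\to+\infty} f(x)/\|x\|=+\infty$ (equivalently, $\operatorname{dom} f^*=\mathbb{R}^J$). (3) $C$ is a nonempty bounded closed (hence compact) subset of $U$. A superscript $*$ on a function denotes the Fenchel conjugate; under these assumptions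 $\nabla f\colon U\to\mathbb{R}^J$ and $\nabla f^*\colon\mathbb{R}^J\to U$ are continuous bijections, inverse to each other. The Bregman distance is $D(x,y)=f(x)-f(y)-\langle\nabla f(y),x-y\rangle$ if $y\in U$, and $D(x,y)=+\infty$ otherwise. For $y\in U$, $\overleftarrow{F}_C(y)=\sup_{x\in C}D(x,y)$. The function $-f^\vee+\iota_{-C}\colon\mathbb{R}^J\to\,]-\infty,+\infty]$ takes the value $-f(-x)$ if $x\in -C$ and $+\infty$ otherwise. *)

(* Defs.v *)
From HB Require Import structures.
From mathcomp Require Import all_boot all_order all_algebra.
From mathcomp Require Import all_classical all_reals all_analysis.

Set Implicit Arguments.
Unset Strict Implicit.
Unset Printing Implicit Defensive.

Import Order.TTheory GRing.Theory Num.Theory.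
Import numFieldNormedType.Exports.

Local Open Scope classical_set_scope.
Local Open Scope ring_scope.

Section Euclidean.
Context {R : realType} {J : nat}.
Implicit Types (x y : 'rV[R]_J) (A : set 'rV[R]_J).

Definition dot x y : R := \sum_(i < J) x ord0 i * y ord0 i.

(* The library's norm on ['rV[R]_J] is the sup norm (it induces the same
   topology), hence a separate Euclidean norm. *)
Definition enorm x : R := Num.sqrt (dot x x).

(* The filter of "||x|| -> +oo". *)
Definition at_infinity : set_system 'rV[R]_J :=
  filter_from setT (fun r : R => [set x | r < enorm x]).

(* [nW] is the norm used on the codomain. *)
Definition locally_lipschitz_on (W : zmodType) (nW : W -> R) A
    (g : 'rV[R]_J -> W) : Prop :=
  forall x, A x -> exists L : R, exists2 V, nbhs x V &
    forall y z, (A `&` V) y -> (A `&` V) z ->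
      nW (g y - g z) <= L * enorm (y - z).

Definition elocally_lipschitz_on A (g : 'rV[R]_J -> \bar R) : Prop :=
  (forall x, A x -> g x \is a fin_num) /\
  locally_lipschitz_on Num.norm A (fine \o g).

End Euclidean.

Section ConvexAnalysis.
Context {R : realType} {J : nat}.
Implicit Types (f : 'rV[R]_J -> \bar R) (x y v : 'rV[R]_J).
Implicit Types A C : set 'rV[R]_J.

Definition edom f : set 'rV[R]_J := [set x | (f x < +oo)%E].

Definition idom f : set 'rV[R]_J := (edom f)°.

Definition eproper f : Prop := edom f !=set0 /\ forall x, f x != -oo%E.

Definition econvex f : Prop :=
  forall x y (t : R), 0 < t < 1 ->
    (f (t *: x + (1 - t) *: y)%R <= t%:E * f x + (1 - t)%R%:E * f y)%E.

Definition estrictly_convex_on A f : Prop :=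
  forall x y (t : R), A x -> A y -> x != y -> 0 < t < 1 ->
    (f (t *: x + (1 - t) *: y)%R < t%:E * f x + (1 - t)%R%:E * f y)%E.

(* For proper [f] this set is empty at every [x] outside [edom f]. *)
Definition subdiff f x : set 'rV[R]_J :=
  [set v | forall y, (f x + (dot v (y - x)%R)%:E <= f y)%E].

Definition dom_subdiff f : set 'rV[R]_J := [set x | subdiff f x !=set0].

(* The vector representing the differential of [f] at [x]; meaningful where
   [f] is finite near [x] and differentiable at [x]. *)
Definition gradient f x : 'rV[R]_J :=
  \row_i 'd (fine \o f) x (delta_mx ord0 i).

Definition essentially_smooth f : Prop :=
  [/\ idom f !=set0,
      (forall x, idom f x -> differentiable (fine \o f) x) &
      (forall (u : nat -> 'rV[R]_J) x, (forall n, idom f (u n)) ->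
         (closure (idom f) `\` idom f) x -> u n @[n --> \oo] --> x ->
         enorm (gradient f (u n)) @[n --> \oo] --> +oo)].

Definition essentially_strictly_convex f : Prop :=
  forall A, A `<=` dom_subdiff f -> @convex_set R 'rV[R]_J A ->
    estrictly_convex_on A f.

Definition legendre f : Prop :=
  [/\ eproper f, lower_semicontinuous f, econvex f,
      essentially_smooth f & essentially_strictly_convex f].

Definition one_coercive f : Prop :=
  (f x * (enorm x)^-1%R%:E)%E @[x --> at_infinity] --> +oo%E.

Definition twice_continuously_differentiable_on A f : Prop :=
  [/\ (forall x, A x -> differentiable (fine \o f) x),
      (forall x, A x -> differentiable (gradient f) x) &
      {within A, continuous (fun x => 'J (gradient f) x)}].

Definition fenchel f v : \bar R :=
  ereal_sup [set ((dot v x)%:E - f x)%E | x in setT].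

Definition bregman f x y : \bar R :=
  if y \in idom f then (f x - f y - (dot (gradient f y) (x - y)%R)%:E)%E
  else +oo%E.

Definition left_farthest f C y : \bar R :=
  ereal_sup [set bregman f x y | x in C].

(* -f^\vee + \iota_{-C}; defined by cases since [-oo + +oo = -oo] in [\bar R]. *)
Definition neg_reflect f C x : \bar R :=
  if x \in [set - c | c in C] then (- f (- x)%R)%E else +oo%E.

End ConvexAnalysis.

(* Main.v *)
Require Import Defs.
From HB Require Import structures.
From mathcomp Require Import all_boot all_order all_algebra.
From mathcomp Require Import all_classical all_reals all_analysis.
From mathcomp Require Import ring lra.

(* For every v, <v, .> - f has a unique maximizer m v: coercivity and lower
   semicontinuity give existence, essential strict convexity uniqueness. It
   is interior to the domain, since at a boundary point carrying a
   subgradient the gradients stay bounded along a segment into the interior,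
   against essential smoothness. Hence grad f (m v) = v. As m is locally
   bounded, continuous, and m v is a subgradient of f^* at v, f^* is Lipschitz
   on bounded sets and grad f^* = m. For y in U the Fenchel-Young equality at
   (y, grad f y) turns D(c, y) into f c - <grad f y, c> + f^*(grad f y), and
   the supremum over c in C is (f^* + (-f^\vee + iota_{-C})^* )(grad f y), where
   the second conjugate is a supremum of affine functions with slopes in the
   bounded set -C, hence Lipschitz. *)

Import Order.TTheory GRing.Theory Num.Theory.
Import numFieldNormedType.Exports.

Local Open Scope classical_set_scope.
Local Open Scope ring_scope.

(** * Inner product, Euclidean norm and their comparison with the sup norm *)

Section DotEnorm.
Context {R : realType} {J : nat}.
Implicit Types (x y z v : 'rV[R]_J) (t : R).

Lemma dotC x y : dot x y = dot y x.
Proof. by apply: eq_bigr => i _; rewrite mulrC. Qed.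

Lemma dotDr x y z : dot x (y + z) = dot x y + dot x z.
Proof.
by rewrite /dot -big_split; apply: eq_bigr => i _; rewrite mxE mulrDr.
Qed.

Lemma dotZr t x y : dot x (t *: y) = t * dot x y.
Proof.
by rewrite /dot mulr_sumr; apply: eq_bigr => i _; rewrite mxE mulrCA.
Qed.

Lemma dotNr x y : dot x (- y) = - dot x y.
Proof. by rewrite -scaleN1r dotZr mulN1r. Qed.

Lemma dotBr x y z : dot x (y - z) = dot x y - dot x z.
Proof. by rewrite dotDr dotNr. Qed.

Lemma dotDl x y z : dot (y + z) x = dot y x + dot z x.
Proof. by rewrite dotC dotDr !(dotC x). Qed.

Lemma dotNl x y : dot (- y) x = - dot y x.
Proof. by rewrite dotC dotNr (dotC x). Qed.

Lemma dotBl x y z : dot (y - z) x = dot y x - dot z x.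
Proof. by rewrite dotDl dotNl. Qed.

Lemma dotZl t x y : dot (t *: y) x = t * dot y x.
Proof. by rewrite dotC dotZr (dotC x). Qed.

Lemma dot_delta x i : dot x (delta_mx ord0 i) = x ord0 i.
Proof.
rewrite /dot (bigD1 i)//= big1 ?addr0 => [|j ji].
  by rewrite mxE !eqxx mulr1.
by rewrite mxE (negbTE ji) andbF mulr0.
Qed.

Lemma coord_le_norm x i : `|x ord0 i| <= `|x|.
Proof.
rewrite [leRHS]/Num.Def.normr/= mx_normrE.
exact: (le_bigmax _ (fun ij => `|x ij.1 ij.2|) (ord0, i)).
Qed.

Lemma norm_le_coord x t : 0 <= t -> (forall i, `|x ord0 i| <= t) -> `|x| <= t.
Proof.
move=> t0 xt; rewrite [leLHS]/Num.Def.normr/= mx_normrE.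
by apply: bigmax_le => // -[i j] _ /=; rewrite ord1.
Qed.

Lemma dot_le_norm x y : `|dot x y| <= J%:R * `|x| * `|y|.
Proof.
rewrite (le_trans (ler_norm_sum _ _ _))//.
rewrite (@le_trans _ _ (\sum_(i < J) `|x| * `|y|))//.
  by apply: ler_sum => i _; rewrite normrM ler_pM// coord_le_norm.
by rewrite sumr_const card_ord -[in leLHS]mulr_natl mulrA.
Qed.

Lemma dotxx_ge0 x : 0 <= dot x x.
Proof. by apply: sumr_ge0 => i _; rewrite -expr2 sqr_ge0. Qed.

Lemma enorm_ge0 x : 0 <= enorm x.
Proof. exact: sqrtr_ge0. Qed.

Lemma norm_le_enorm x : `|x| <= enorm x.
Proof.
apply: norm_le_coord => [|i]; first exact: enorm_ge0.
rewrite -sqrtr_sqr ler_wsqrtr// /dot (bigD1 i)//= expr2 lerDl.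
by apply: sumr_ge0 => j _; rewrite -expr2 sqr_ge0.
Qed.

Lemma enorm_le_norm x : enorm x <= J%:R * `|x|.
Proof.
have J0 : 0 <= J%:R * `|x| by rewrite mulr_ge0.
rewrite -[leRHS]ger0_norm// -sqrtr_sqr ler_wsqrtr//.
rewrite (le_trans (ler_norm _))// (le_trans (dot_le_norm _ _))//.
rewrite exprMn -mulrA -expr2 ler_wpM2r ?sqr_ge0// expr2.
by case: (J) => [|n]; [rewrite mul0r | rewrite ler_peMr// ler1n].
Qed.

Lemma dotxx_eq0 x : dot x x = 0 -> x = 0.
Proof.
move=> x0; apply/eqP; rewrite -normr_le0 (le_trans (norm_le_enorm _))//.
by rewrite /enorm x0 sqrtr0.
Qed.

Lemma near_dist_le x t : 0 < t -> \forall y \near x, `|x - y| <= t.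
Proof.
move=> t0; apply/nbhs_ballP; exists t => //= y.
by rewrite -ball_normE/= => /ltW.
Qed.

Lemma continuous_dot v : continuous (dot v).
Proof.
move=> x; apply/(@cvgrPdist_le _ _ _ _ (nbhs_filter x)) => e e0.
have K0 : 0 < J%:R * `|v| + 1 by rewrite ltr_wpDl// mulr_ge0.
near=> y.
rewrite -dotBr (le_trans (dot_le_norm _ _))//.
rewrite (@le_trans _ _ ((J%:R * `|v| + 1) * `|x - y|))//.
  by rewrite ler_wpM2r// lerDl.
rewrite -ler_pdivlMl//; near: y.
by apply: near_dist_le; rewrite mulr_gt0// invr_gt0.
Unshelve. all: by end_near. Qed.

Lemma linear_dot v : linear_for *%R (dot v).
Proof. by move=> a x y; rewrite dotDr dotZr. Qed.

(** [enorm] is at most [J] times the sup norm, so a Euclidean Lipschitz bound gives continuity for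
    the library topology. The added 1 makes the constant positive, so that it can be divided by. *)
Lemma lipschitz_continuous_at A (g : 'rV[R]_J -> R) x :
    locally_lipschitz_on Num.norm A g -> A° x -> {for x, continuous g}.
Proof.
move=> gA Ax; have [L [V Vx gV]] := gA x (interior_subset Ax).
have K0 : 0 < `|L| * J%:R + 1 by rewrite ltr_wpDl// mulr_ge0.
apply/(@cvgrPdist_le _ _ _ _ (nbhs_filter x)) => e e0.
near=> y.
have AVy : (A `&` V) y by split; near: y => //.
have AVx : (A `&` V) x by split; [exact: interior_subset|exact: nbhs_singleton].
rewrite (le_trans (gV _ _ AVx AVy))//.
rewrite (@le_trans _ _ ((`|L| * J%:R + 1) * `|x - y|))//.
  rewrite (@le_trans _ _ (`|L| * enorm (x - y)))//.
    by rewrite ler_wpM2r ?enorm_ge0// ler_norm.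
  rewrite (@le_trans _ _ (`|L| * (J%:R * `|x - y|)))//.
    by rewrite ler_wpM2l// enorm_le_norm.
  by rewrite mulrA ler_wpM2r// lerDl.
rewrite -ler_pdivlMl//; near: y.
by apply: near_dist_le; rewrite mulr_gt0// invr_gt0.
Unshelve. all: by end_near. Qed.

End DotEnorm.

(** * Gradients of convex functions: subgradient inequality, uniqueness, continuity *)

Lemma diff_gradient {R : realType} {J : nat} (f : 'rV[R]_J -> \bar R) x v :
  'd (fine \o f) x v = dot (gradient f x) v.
Proof.
rewrite [in LHS](row_sum_delta v) linear_sum.
by apply: eq_bigr => i _; rewrite linearZ mxE mulrC.
Qed.

Section Gradient.
Context {R : realType} {J : nat}.
Variable f : 'rV[R]_J -> \bar R.
Implicit Types (x y v h : 'rV[R]_J) (t e : R).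
Hypotheses (f_proper : eproper f) (f_convex : econvex f).
Hypothesis f_diff : forall x, idom f x -> differentiable (fine \o f) x.

Let phi := fine \o f.

Lemma idom_edom x : idom f x -> edom f x.
Proof. exact: interior_subset. Qed.

Lemma nbhs_idom x : idom f x -> nbhs x (idom f).
Proof. by move=> Ux; exact: open_nbhs_nbhs (conj (open_interior _) Ux). Qed.

Lemma fineE_edom x : edom f x -> f x = (fine (f x))%:E.
Proof.
by move=> fx; rewrite fineK// fin_numE (f_proper.2 x)/= -ltey.
Qed.

Lemma econvex_fine x y t : edom f x -> edom f y -> 0 < t < 1 ->
  edom f (t *: x + (1 - t) *: y) /\
  phi (t *: x + (1 - t) *: y) <= t * phi x + (1 - t) * phi y.
Proof.
move=> fx fy t01; have := f_convex x y t t01.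
rewrite (fineE_edom _ fx) (fineE_edom _ fy) -!EFinM -EFinD => le_f.
have fxy : edom f (t *: x + (1 - t) *: y) by exact: le_lt_trans le_f (ltry _).
by split => //; move: le_f; rewrite (fineE_edom _ fxy) lee_fin.
Qed.

(** The right-hand limit suffices: the convexity estimates below all use small positive steps. *)
Lemma gradient_cvg x h : differentiable phi x ->
  t^-1 * (phi (x + t *: h) - phi x) @[t --> 0^'+] --> dot (gradient f x) h.
Proof.
move=> dx; rewrite -diff_gradient -deriveE//; apply: cvg_dnbhs_at_right.
rewrite (_ : (fun t => _) =
    fun t => t^-1 *: ((phi \o shift x) (t *: h) - phi x)).
  exact: (@diff_derivable _ _ _ _ _ h dx).
by apply/funext => t; rewrite /= [x + _]addrC.
Qed.

Lemma cvg_ray x h : x + t *: h @[t --> 0^'+] --> x.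
Proof.
apply: cvg_at_right_filter; rewrite -[X in _ --> X]addr0 -(scale0r h).
apply: cvgD; first exact: cvg_cst.
by apply: cvgZr_tmp; exact: cvg_id.
Qed.

(** By convexity the difference quotient towards [x] with step [t < 1] is at most [phi x - phi y];
    let [t] tend to 0. *)
Lemma subdiff_gradient y : idom f y -> subdiff f y (gradient f y).
Proof.
move=> Uy x; have fy := idom_edom _ Uy.
have [fx|] := pselect (edom f x); last first.
  by move=> /negP; rewrite -leNgt leye_eq => /eqP ->; rewrite leey.
rewrite (fineE_edom _ fx) (fineE_edom _ fy) -EFinD lee_fin addrC -lerBrDr.
apply: (cvgr_to_le (gradient_cvg _ (x - y) (f_diff _ Uy))).
near=> t.
have t0 : 0 < t by near: t; exact: nbhs_right_gt.
have t1 : t < 1 by near: t; exact: nbhs_right_lt.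
have [|_] := econvex_fine _ _ t fx fy; first by rewrite t0.
rewrite ler_pdivrMl//.
have -> : t *: x + (1 - t) *: y = y + t *: (x - y).
  by rewrite scalerBl scale1r scalerBr addrA addrAC [RHS]addrA addrC addrA.
rewrite /phi/=; lra.
Unshelve. all: by end_near. Qed.

Lemma gradient_ineq x h t : idom f x -> edom f (x + t *: h) ->
  phi x + t * dot (gradient f x) h <= phi (x + t *: h).
Proof.
move=> Ux fxt; have := subdiff_gradient _ Ux (x + t *: h).
rewrite (fineE_edom _ (idom_edom _ Ux)) (fineE_edom _ fxt).
rewrite (_ : x + t *: h - x = t *: h); last by rewrite addrC addKr.
by rewrite dotZr -EFinD lee_fin.
Qed.

(** Dividing the subgradient inequality at [y + t h] by [t] and letting [t] tend to 0 gives
    [<v, h> <= <grad f y, h>] for every [h]; the choice [h = v - grad f y] forces equality. *)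
Lemma subdiff_eq_gradient y v : idom f y -> subdiff f y v -> v = gradient f y.
Proof.
move=> Uy fyv; have fy := idom_edom _ Uy.
have le_h h : dot v h <= dot (gradient f y) h.
  apply: (cvgr_to_ge (gradient_cvg _ h (f_diff _ Uy))).
  have Uh := cvg_ray y h _ (nbhs_idom _ Uy).
  near=> t.
  have t0 : 0 < t by near: t; exact: nbhs_right_gt.
  have fyt : edom f (y + t *: h) by apply: idom_edom; near: t.
  have := fyv (y + t *: h).
  rewrite (fineE_edom _ fy) (fineE_edom _ fyt).
  rewrite (_ : y + t *: h - y = t *: h); last by rewrite addrC addKr.
  rewrite dotZr -EFinD lee_fin.
  by rewrite ler_pdivlMl// /phi/= => ?; lra.
apply/eqP; rewrite eq_sym -subr_eq0; apply/eqP/dotxx_eq0/le_anti.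
rewrite dotxx_ge0 andbT; have := le_h (v - gradient f y).
by rewrite -(opprB v) dotNr dotNl opprK dotBl; lra.
Unshelve. all: by end_near. Qed.

(** For a fixed step [t], the quotient at [x] bounds [<grad f x, h>] from above and is continuous in
    [x]. *)
Lemma gradient_usc y h e : 0 < e -> idom f y ->
  \forall x \near y, dot (gradient f x) h <= dot (gradient f y) h + e.
Proof.
move=> e0 Uy.
have e20 : 0 < e / 2 by rewrite divr_gt0.
(* Half of [e] pays for the fixed step [t] at [y], the other half for moving the base point from [y]
   to [x]. *)
have [t [t0 Ut tle]] : exists t, [/\ 0 < t, idom f (y + t *: h) &
    t^-1 * (phi (y + t *: h) - phi y) <= dot (gradient f y) h + e / 2].
  have Uh := cvg_ray y h _ (nbhs_idom _ Uy).
  have Dh := gradient_cvg _ h (f_diff _ Uy).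
  apply: (@filter_ex R (at_right 0) (at_right_proper_filter 0)).
  near=> t; split.
  - by near: t; exact: nbhs_right_gt.
  - by near: t.
  - by near: t; apply: (cvgr_le _ Dh); rewrite ltrDl.
have cy : phi x @[x --> y] --> phi y.
  exact: differentiable_continuous (f_diff _ Uy).
have sy : x + t *: h @[x --> y] --> y + t *: h.
  by apply: (@cvgD _ _ _ _ (nbhs_filter y)); [exact: cvg_id|exact: cvg_cst].
have cyt : phi (x + t *: h) @[x --> y] --> phi (y + t *: h).
  by apply: (cvg_comp _ _ sy); exact: differentiable_continuous (f_diff _ Ut).
have cd : phi (x + t *: h) - phi x @[x --> y] --> phi (y + t *: h) - phi y.
  by apply: (@cvgB _ _ _ _ (nbhs_filter y)).
have near_U := nbhs_idom _ Uy.
have near_Ut := sy _ (nbhs_idom _ Ut).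
have near_d : \forall x \near y, phi (x + t *: h) - phi x <=
    phi (y + t *: h) - phi y + t * (e / 2).
  by apply: (@cvgr_le _ _ _ (nbhs_filter y) _ _ cd); rewrite ltrDl mulr_gt0.
apply: (@filterS3 _ _ (nbhs_filter y) _ _ _ _ _ near_U near_Ut near_d).
move=> x Ux Uxt.
move=> dx; have gx := gradient_ineq _ h t Ux (idom_edom _ Uxt).
rewrite -(ler_pM2l t0) [e in _ + e]splitr addrA mulrDr.
apply: (@le_trans _ _ (phi (x + t *: h) - phi x)); first by rewrite lerBrDl.
by apply: (le_trans dx); rewrite lerD2r -ler_pdivrMl.
Unshelve. all: by end_near. Qed.

(** The one-sided bound for [h] and for [- h] together is a two-sided one. *)
Lemma gradient_near y h e : 0 < e -> idom f y ->
  \forall x \near y, `|dot (gradient f y) h - dot (gradient f x) h| <= e.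
Proof.
move=> e0 Uy.
apply: (@filterS2 _ _ (nbhs_filter y) _ _ _ _ (gradient_usc _ h _ e0 Uy)
  (gradient_usc _ (- h) _ e0 Uy)) => x.
move: (gradient f x) (gradient f y) => a b.
rewrite !dotNr ler_norml; move: (dot a h) (dot b h) => p q; lra.
Qed.

Lemma continuous_gradient y : idom f y -> {for y, continuous (gradient f)}.
Proof.
move=> Uy; apply/(@cvgrPdist_le _ _ _ _ (nbhs_filter y)) => e e0.
suff : \forall x \near y, forall i : 'I_J,
    `|(gradient f y - gradient f x) ord0 i| <= e.
  by apply: (@filterS _ _ (nbhs_filter y)) => x /(norm_le_coord _ _ (ltW e0)).
apply: (@filter_forall _ _ _ _ (nbhs_filter y)) => i.
have := gradient_near _ (delta_mx ord0 i) _ e0 Uy.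
apply: (@filterS _ _ (nbhs_filter y)) => x.
by rewrite -dotBl dot_delta.
Qed.

End Gradient.

(** * Minimization of lower semicontinuous functions *)

Lemma lsc_compact_min {R : realType} {T : topologicalType} (K : set T)
    (g : T -> \bar R) : lower_semicontinuous g -> (forall x, g x != -oo%E) ->
    compact K -> K !=set0 ->
  exists2 c, K c & forall x, K x -> (g c <= g x)%E.
Proof.
move=> g_lsc gNy cK [x0 Kx0].
(* The sublevel sets on [K] are nested, hence a filter base, and compactness gives a cluster point
   [c]. If [g x < g c], lower semicontinuity yields a neighbourhood of [c] that misses [B x]. *)
pose B x := [set y | K y /\ (g y <= g x)%E].
have FF : ProperFilter (filter_from K B).
  apply: filter_from_proper; last by move=> x Kx; exists x; split.
  apply: filter_from_filter; first by exists x0.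
  move=> x y Kx Ky; have [xy|/ltW yx] := leP (g x) (g y).
    by exists x => // z [Kz zx]; split; split => //; exact: le_trans xy.
  by exists y => // z [Kz zy]; split; split => //; exact: le_trans yx.
have [|c [Kc Fc]] := cK _ FF; first by exists x0 => // y [].
exists c => // x Kx; rewrite leNgt; apply/negP => xc.
have gx : g x = (fine (g x))%:E.
  by rewrite fineK// fin_numE gNy/= -ltey (lt_le_trans xc)// leey.
move: (xc); rewrite gx => /g_lsc[V Vc gV].
have [|z [[_ zx]]] := Fc (B x) V _ Vc; first by exists x => // y.
by move=> /gV; rewrite -gx ltNge zx.
Qed.

(** A real [b] strictly between [a - l x] and [f x] splits the task: near [x], [f] exceeds [b] and
    [l] exceeds [a - b]. *)
Lemma lsc_addr {R : realType} {T : topologicalType} (f : T -> \bar R)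
    (l : T -> R) : lower_semicontinuous f -> continuous l ->
  lower_semicontinuous (fun x => f x + (l x)%:E)%E.
Proof.
move=> f_lsc cl x a; rewrite -lteBlDr// -EFinB => axf.
have [b [ab bf]] : exists b, a - l x < b /\ (b%:E < f x)%E.
  case: (f x) axf => [r|_|//]; last by exists (a - l x + 1); rewrite ltrDl ltry.
  rewrite lte_fin => ar.
  by exists ((a - l x + r) / 2); rewrite lte_fin !midf_lt.
have [V Vx fV] := f_lsc _ _ bf.
exists (V `&` [set y | a - b < l y]).
  apply: filterI => //.
  by apply: (cvgr_gt _ (cl x)); rewrite ltrBlDl -ltrBlDr.
move=> y [/fV bfy /= aby]; rewrite -lteBlDr// -EFinB.
by apply: le_lt_trans bfy; rewrite lee_fin; lra.
Qed.

(** * Existence of maximizers of [<v, .> - f] by coercivity *)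

Section Coercive.
Context {R : realType} {J : nat}.
Variable f : 'rV[R]_J -> \bar R.
Implicit Types (x y v : 'rV[R]_J).
Hypotheses (f_proper : eproper f) (f_coercive : one_coercive f).

Lemma coercive_ge (A : R) : 0 <= A ->
  exists r, forall x, r < `|x| -> ((A * `|x|)%:E <= f x)%E.
Proof.
move=> A0; have [r _ rP] := f_coercive _ (ereal_nbhs_pinfty_ge (num_real A)).
exists (Num.max r 0) => x; rewrite gt_max => /andP[rx x0].
have ex : `|x| <= enorm x := norm_le_enorm x.
have ex0 : 0 < enorm x by exact: lt_le_trans ex.
have := rP x (lt_le_trans rx ex).
rewrite /= lee_pdivlMr//.
by apply: le_trans; rewrite -EFinM lee_fin ler_wpM2l.
Qed.

(** Far out [f] grows at slope at least [J B + 1], while [<v, x>] is at most [J B |x|]. The surplus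
    [|x|] exceeds [m], which absorbs the value at [x0]; the radius is the same for all [v] with
    [|v| <= B]. *)
Lemma conjugate_tail x0 (B : R) : edom f x0 -> 0 <= B ->
  exists2 rho, 0 <= rho & forall v x, `|v| <= B -> rho < `|x| ->
    ((dot v x)%:E - f x < (dot v x0)%:E - f x0)%E.
Proof.
move=> fx0 B0; have JB0 : 0 <= J%:R * B by rewrite mulr_ge0.
have [|r rP] := coercive_ge (J%:R * B + 1); first by rewrite addr_ge0.
pose m := J%:R * B * `|x0| + `|fine (f x0)|.
have m0 : 0 <= m by rewrite addr_ge0// mulr_ge0.
exists (Num.max r m); first by rewrite le_max m0 orbT.
move=> v x vB; rewrite gt_max => /andP[/rP fx mx].
rewrite (fineE_edom _ f_proper _ fx0) -EFinB.
case: (f x) fx => [s| |]//=; last by rewrite ltNyr.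
rewrite lee_fin -EFinB lte_fin => fx.
have dv y : `|dot v y| <= J%:R * B * `|y|.
  rewrite (le_trans (dot_le_norm _ _))// ler_wpM2r// ler_wpM2l//.
have := dv x; have := dv x0; rewrite !ler_norml.
have := ler_norm (fine (f x0)); rewrite -/m in mx *.
move: mx; rewrite /m mulrDl mul1r in fx *.
by move=> ? ? /andP[? ?] /andP[? ?]; lra.
Qed.

Hypothesis f_lsc : lower_semicontinuous f.

(** A minimizer of [f - <v, .>] over a large ball is a global one, because points outside the ball
    do worse than [x0], which lies inside. *)
Lemma exists_subdiff v : exists2 x, edom f x & subdiff f x v.
Proof.
have [x0 fx0] := f_proper.1.
have [rho rho0 rhoP] := conjugate_tail x0 _ fx0 (normr_ge0 v).
(* The ball of this radius contains [x0], and its complement lies in the region controlled by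
   [conjugate_tail]. *)
pose r := rho + `|x0| + 1.
have r0 : 0 < r by rewrite ltr_wpDl// addr_ge0.
pose K := [set x : 'rV[R]_J | `|x| <= r].
have cK : compact K.
  apply: bounded_closed_compact.
    exists r; split; first exact: num_real.
    by move=> M rM x /le_trans; apply; exact: ltW.
  rewrite (_ : K = closed_ball 0 r); first exact: closed_ball_closed.
  rewrite closed_ballE//; apply/seteqP; split => x.
    by rewrite /closed_ball_/= sub0r normrN.
  by rewrite /closed_ball_/= sub0r normrN.
have Kx0 : K x0 by rewrite /K/= /r; lra.
have gNy x : (f x + (dot (- v) x)%:E)%E != -oo%E.
  by rewrite adde_eq_ninfty negb_or f_proper.2.
have g_lsc := lsc_addr _ _ f_lsc (continuous_dot (- v)).
have [c Kc cP] := lsc_compact_min _ _ g_lsc gNy cK (ex_intro _ _ Kx0).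
have fc : edom f c.
  rewrite /edom/= ltey; apply/eqP => fc; have := cP _ Kx0.
  by rewrite fc (fineE_edom _ f_proper _ fx0) -EFinD.
have fcE := fineE_edom _ f_proper _ fc.
exists c => // y.
have [fy|] := pselect (edom f y); last first.
  by move=> /negP; rewrite -leNgt leye_eq => /eqP ->; rewrite leey.
have fyE := fineE_edom _ f_proper _ fy.
have fx0E := fineE_edom _ f_proper _ fx0.
have [Ky|] := pselect (K y).
  have := cP _ Ky; rewrite fcE fyE -!EFinD !lee_fin !dotNl dotBr.
  by move: (dot v c) (dot v y) => p q; lra.
move=> /negP; rewrite -ltNge => ry.
have ry' : rho < `|y|.
  by apply: le_lt_trans ry; rewrite /r; have := normr_ge0 x0; lra.
have := cP _ Kx0; have := rhoP v y (lexx _) ry'.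
rewrite fcE fyE fx0E -!EFinB -!EFinD lte_fin !lee_fin !dotNl dotBr.
by move: (dot v c) (dot v y) (dot v x0) => p q s; lra.
Qed.

End Coercive.

(** * Points carrying a subgradient are interior *)

Section Boundary.
Context {R : realType} {J : nat}.
Variables (f : 'rV[R]_J -> \bar R) (g : 'rV[R]_J -> 'rV[R]_J).
Implicit Types (x y v : 'rV[R]_J) (t : R).
Hypotheses (f_proper : eproper f) (f_convex : econvex f).
Hypothesis f_cont : forall x, idom f x -> {for x, continuous (fine \o f)}.
Hypothesis g_subdiff : forall x, idom f x -> subdiff f x (g x).

Let phi := fine \o f.

(** With [x] and [t] fixed, the continuous map [p] inverts [w |-> t w + (1 - t) x]. Points [z] near
    the image of [x0] have [p z] in [dom f], so convexity puts [z] itself in [dom f]. *)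
Lemma segment_idom x x0 t : edom f x -> idom f x0 -> 0 < t < 1 ->
  idom f (t *: x0 + (1 - t) *: x).
Proof.
move=> fx Ux0 t01; have t0 : t != 0 by rewrite gt_eqF//; case/andP: t01.
pose p z := t^-1 *: (z - (1 - t) *: x).
have pE : p (t *: x0 + (1 - t) *: x) = x0.
  by rewrite /p addrK scalerA mulVf// scale1r.
have cp w : p z @[z --> w] --> p w.
  apply: (@cvgZl_tmp _ _ _ _ (nbhs_filter _)).
  by apply: (@cvgB _ _ _ _ (nbhs_filter _)); [exact: cvg_id|exact: cvg_cst].
have := cp (t *: x0 + (1 - t) *: x) (edom f); rewrite pE => /(_ Ux0).
apply: (@filterS _ _ (nbhs_filter _)) => z fpz.
have [+ _] := econvex_fine f f_proper f_convex _ _ _ fpz fx t01.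
by rewrite /p scalerA divff// scale1r subrK.
Qed.

Lemma subdiff_fine x y v : edom f x -> edom f y -> subdiff f x v ->
  phi x + dot v (y - x) <= phi y.
Proof.
move=> fx fy /(_ y).
by rewrite (fineE_edom _ f_proper _ fx) (fineE_edom _ f_proper _ fy).
Qed.

(* Along the segment from a point [x] of [dom f] with a subgradient [v] to an
   interior point [x0], the gradients are bounded independently of [t]:
   monotonicity of the subdifferential bounds [<g, x0 - x>] from below, and the
   subgradient inequality on a ball around [x0] bounds all other directions. *)
Lemma gradient_segment_bounded x x0 v : edom f x -> idom f x0 ->
    subdiff f x v ->
  exists M, forall t, 0 < t < 1 -> `|g (t *: x0 + (1 - t) *: x)| <= M.
Proof.
move=> fx Ux0 fxv; have fx0 := idom_edom _ _ Ux0.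
have near_ball : \forall z \near x0, edom f z /\ phi z <= phi x0 + 1.
  apply: (@filterI _ _ (nbhs_filter x0)); first exact: Ux0.
  by apply: (@cvgr_le _ _ _ (nbhs_filter x0) _ _ (f_cont _ Ux0)); rewrite ltrDl.
have [e e0 eP] : exists2 e, 0 < e & forall z, `|x0 - z| <= e ->
    edom f z /\ phi z <= phi x0 + 1.
  have /nbhs_ballP[e /= e0 eP] := near_ball.
  exists (e / 2); first by rewrite divr_gt0.
  move=> z x0z; apply: eP; rewrite -ball_normE/= (le_lt_trans x0z)//.
  by rewrite ltr_pdivrMr// ltr_pMr// ltr1n.
pose a := dot v (x0 - x).
(* Below, [phi u >= phi x + t a] and [<G, x0 - u> >= (1 - t) a]; the two multiples of [a] add up to
   [a], so [t] drops out of the bound. *)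
pose M := phi x0 + 1 - phi x - a.
exists (`|M| / e) => t t01.
pose u := t *: x0 + (1 - t) *: x.
have Uu : idom f u := segment_idom _ _ _ fx Ux0 t01.
have fu := idom_edom _ _ Uu.
have gu := g_subdiff _ Uu.
rewrite -/u; move: (g u) gu => G gu.
have uxE : u - x = t *: (x0 - x).
  by rewrite /u scalerBl scale1r addrA addrAC addrK scalerBr.
have xuE : x - u = - (t *: (x0 - x)) by rewrite -uxE opprB.
have x0uE : x0 - u = (1 - t) *: (x0 - x).
  by rewrite -[x0 in LHS](subrK x) -addrA xuE scalerBl scale1r.
have dirP w : `|w| <= e -> dot G w <= M.
  move=> we; have [|fw wle] := eP (x0 + w).
    by rewrite opprD addrA subrr add0r normrN.
  have := subdiff_fine _ _ _ fx fu fxv.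
  have := subdiff_fine _ _ _ fu fx gu.
  have := subdiff_fine _ _ _ fu fw gu.
  rewrite uxE xuE addrAC x0uE dotDr dotNr !dotZr -/a.
  case/andP: t01 => t0 t1.
  move: (dot G (x0 - x)) (dot G w) wle => p q wle h1 h2 h3.
  have ap : a <= p by rewrite -(ler_pM2l t0); lra.
  have : (1 - t) * a <= (1 - t) * p by rewrite ler_wpM2l//; lra.
  rewrite /M; lra.
(* Testing [dirP] on [e] and [- e] times a basis vector bounds each coordinate of [G]. *)
have coordP i : `|G ord0 i| * e <= M.
  have de : `|delta_mx ord0 i : 'rV[R]_J| <= 1.
    apply: norm_le_coord => // j; rewrite mxE eqxx/=.
    by case: eqP; rewrite ?normr1 ?normr0.
  have eE (b : R) : `|b| = e -> `|b *: delta_mx ord0 i : 'rV[R]_J| <= e.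
    by move=> be; rewrite normrZ be ler_piMr// ltW.
  have := dirP _ (eE (- e) _); have := dirP _ (eE e _).
  rewrite !dotZr dot_delta normrN gtr0_norm// => /(_ erefl) h1 /(_ erefl) h2.
  by rewrite -[e in leLHS](gtr0_norm e0) -normrM ler_norml; lra.
apply: norm_le_coord => [|i]; first by rewrite divr_ge0// ltW.
by rewrite ler_pdivlMr// (le_trans (coordP i))// ler_norm.
Qed.

Hypothesis g_blowup : forall (u : nat -> 'rV[R]_J) x,
  (forall n, idom f (u n)) -> (closure (idom f) `\` idom f) x ->
  u n @[n --> \oo] --> x -> enorm (g (u n)) @[n --> \oo] --> +oo.

(** If [x] were not interior, the segment points [u n] would approach a boundary point, where [g]
    must blow up, although [g] is bounded along the segment. *)
Lemma subdiff_idom x v : idom f !=set0 -> edom f x -> subdiff f x v -> idom f x.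
Proof.
move=> [x0 Ux0] fx fxv; apply: contrapT => Ux.
(* The shift by two keeps [t n] strictly below 1 already at [n = 0]. *)
pose t n : R := n.+2%:R^-1.
have t01 n : 0 < t n < 1 by rewrite invr_gt0 ltr0n invf_lt1 ?ltr0n// ltr1n.
pose u n := t n *: x0 + (1 - t n) *: x.
have Uu n : idom f (u n) by exact: segment_idom.
have t_cvg : t n @[n --> \oo] --> (0 : R).
  have := @cvg_harmonic R; rewrite -(@cvg_shiftS R (@harmonic R)).
  exact.
have u_cvg : u n @[n --> \oo] --> x.
  have : u n @[n --> \oo] --> 0 *: x0 + (1 - 0) *: x.
    apply: cvgD; apply: cvgZr_tmp => //.
    by apply: cvgB => //; exact: cvg_cst.
  by rewrite scale0r add0r subr0 scale1r.
have clx : closure (idom f) x.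
  move=> B /u_cvg uB; near \oo => n; exists (u n); split; first exact: Uu.
  by near: n.
have /cvgryPgt := g_blowup u x Uu (conj clx Ux) u_cvg.
have [M gM] := gradient_segment_bounded _ _ _ fx Ux0 fxv.
move=> /(_ (J%:R * M)) /(@filter_ex _ _ _)[n].
apply/negP; rewrite -leNgt (le_trans (enorm_le_norm _))// ler_wpM2l//.
exact: gM.
Unshelve. all: by end_near. Qed.

End Boundary.

(** * Uniqueness of the point with a given subgradient *)

Section StrictConvexity.
Context {R : realType} {J : nat}.
Variable f : 'rV[R]_J -> \bar R.
Implicit Types (x y v : 'rV[R]_J) (t : R).
Hypotheses (f_proper : eproper f) (f_convex : econvex f).

Lemma subdiff_edom x v : subdiff f x v -> edom f x.
Proof.
have [y fy] := f_proper.1; move=> /(_ y) le_fy.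
rewrite /edom/= ltey; apply/eqP => fx; move: le_fy.
by rewrite fx (fineE_edom _ f_proper _ fy).
Qed.

Lemma subdiff_conv x y v t : subdiff f x v -> subdiff f y v -> 0 < t < 1 ->
  subdiff f (t *: x + (1 - t) *: y) v.
Proof.
move=> fxv fyv t01 w; have fx := subdiff_edom _ _ fxv.
have fy := subdiff_edom _ _ fyv.
have [fw|] := pselect (edom f w); last first.
  by move=> /negP; rewrite -leNgt leye_eq => /eqP ->; rewrite leey.
have [fz zle] := econvex_fine _ f_proper f_convex _ _ _ fx fy t01.
rewrite (fineE_edom _ f_proper _ fz) (fineE_edom _ f_proper _ fw).
rewrite -EFinD lee_fin.
have := subdiff_fine _ f_proper _ _ _ fx fw fxv.
have := subdiff_fine _ f_proper _ _ _ fy fw fyv.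
move: zle; rewrite /= !dotBr dotDr !dotZr; case/andP: t01 => t0 t1.
move: (dot v w) (dot v x) (dot v y) => p q r.
move: (fine (f w)) (fine (f x)) (fine (f y)) => d b c hz hy hx.
have : t * (b + (p - q)) <= t * d by rewrite ler_wpM2l// ltW.
have : (1 - t) * (c + (p - r)) <= (1 - t) * d.
  by rewrite ler_wpM2l// subr_ge0 ltW.
by move: (fine _) hz => a hz; lra.
Qed.

Hypothesis f_strict : essentially_strictly_convex f.

(** The points with subgradient [v] form a convex subset of [dom_subdiff f]. At the midpoint [z] of
    two of them, averaging the two subgradient inequalities gives [f z] at least the mean of [f x]
    and [f y], against strict convexity. *)
Lemma subdiff_inj x y v : subdiff f x v -> subdiff f y v -> x = y.
Proof.
move=> fxv fyv; apply/eqP/negPn/negP => xy.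
have fx := subdiff_edom _ _ fxv; have fy := subdiff_edom _ _ fyv.
pose A := [set x | subdiff f x v].
have sA : A `<=` dom_subdiff f by move=> z Az; exists v.
have cA : @convex_set R 'rV[R]_J A.
  apply/convex_setW => a b; rewrite !inE => Aa Ab k k0 k1; rewrite inE.
  by apply: subdiff_conv => //; rewrite k0.
have t01 : 0 < (2^-1 : R) < 1 by lra.
have := f_strict A sA cA x y 2^-1 fxv fyv xy t01.
have [fz _] := econvex_fine _ f_proper f_convex _ _ _ fx fy t01.
have := subdiff_fine _ f_proper _ _ _ fx fz fxv.
have := subdiff_fine _ f_proper _ _ _ fy fz fyv.
rewrite (fineE_edom _ f_proper _ fz) (fineE_edom _ f_proper _ fx).
rewrite (fineE_edom _ f_proper _ fy) -!EFinM -EFinD lte_fin /=.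
rewrite !dotBr dotDr !dotZr.
by move: (fine _) (fine _) (fine _) (dot v x) (dot v y) => a b c p q; lra.
Qed.

End StrictConvexity.

(** * The conjugate [f^*]: finiteness, Lipschitz bounds, gradient *)

Section Conjugate.
Context {R : realType} {J : nat}.
Variables (f : 'rV[R]_J -> \bar R) (m : 'rV[R]_J -> 'rV[R]_J).
Implicit Types (x y v w : 'rV[R]_J) (t : R).
Hypotheses (f_proper : eproper f) (f_lsc : lower_semicontinuous f).
(* [m v] is the maximizer of [<v, .> - f], that is, the value of [grad f^*]. *)
Hypothesis m_subdiff : forall v, subdiff f (m v) v.
Hypothesis m_unique : forall x v, subdiff f x v -> x = m v.
Hypothesis m_bounded : forall B : R, 0 <= B -> exists2 rho : R, 0 <= rho &
  forall v, `|v| <= B -> `|m v| <= rho.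

Let phi := fine \o f.
Let psi := fine \o fenchel f.

(** Fenchel-Young equality: the subgradient inequality says exactly that [x] maximizes
    [<v, .> - f]. *)
Lemma fenchel_subdiff x v : subdiff f x v ->
  fenchel f v = (dot v x - phi x)%:E.
Proof.
move=> fxv; have fx := subdiff_edom _ f_proper _ _ fxv.
apply/eqP; rewrite eq_le; apply/andP; split.
  apply: ge_ereal_sup => _ [y _ <-].
  have [fy|] := pselect (edom f y); last first.
    by move=> /negP; rewrite -leNgt leye_eq => /eqP ->; rewrite leNye.
  have := subdiff_fine _ f_proper _ _ _ fx fy fxv.
  rewrite (fineE_edom _ f_proper _ fy) -EFinB lee_fin dotBr /phi/=.
  by move: (dot v x) (dot v y) => p q; lra.
apply: le_ereal_sup_tmp; exists ((dot v x)%:E - f x)%E; first by exists x.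
by rewrite (fineE_edom _ f_proper _ fx).
Qed.

Lemma fenchel_EFin v : fenchel f v = (psi v)%:E.
Proof. by rewrite /psi/= (fenchel_subdiff _ _ (m_subdiff v)). Qed.

Lemma fenchel_maximizer v : psi v = dot v (m v) - phi (m v).
Proof. by rewrite /psi/= (fenchel_subdiff _ _ (m_subdiff v)). Qed.

(** This makes [m v] a subgradient of [f^*] at [v]: compare the values of [<w, .> - f] at [m w] and
    at [m v]. *)
Lemma conjugate_ineq v w : dot (m v) (w - v) <= psi w - psi v.
Proof.
rewrite !fenchel_maximizer.
have fv := subdiff_edom _ f_proper _ _ (m_subdiff v).
have fw := subdiff_edom _ f_proper _ _ (m_subdiff w).
have := subdiff_fine _ f_proper _ _ _ fw fv (m_subdiff w).
rewrite /phi/= !dotBr !(dotC (m v)).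
by move: (fine _) (fine _) (dot _ _) (dot _ _) (dot _ _) => a b p q r; lra.
Qed.

(** On the ball of radius [B] the subgradients [m v] are bounded by [rho]; the subgradient
    inequality is used at both points. *)
Lemma conjugate_lipschitz B : 0 <= B -> exists2 L : R, 0 <= L &
  forall v w, `|v| <= B -> `|w| <= B -> `|psi v - psi w| <= L * `|v - w|.
Proof.
move=> B0; have [rho rho0 mB] := m_bounded _ B0.
exists (J%:R * rho); first by rewrite mulr_ge0.
have le_psi v w : `|v| <= B -> psi v - psi w <= J%:R * rho * `|v - w|.
  move=> vB; rewrite -lerN2 opprB (le_trans _ (conjugate_ineq v w))//.
  rewrite -(opprB v) dotNr lerN2 (le_trans (ler_norm _))//.
  by rewrite (le_trans (dot_le_norm _ _))// ler_wpM2r// ler_wpM2l// mB.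
move=> v w vB wB; rewrite ler_norml le_psi// andbT.
by rewrite -lerN2 opprB opprK distrC le_psi.
Qed.

(** Near [v] the values of [m] stay in a compact ball. Every cluster point inherits the subgradient
    inequality for [v] by lower semicontinuity, so it is [m v] by uniqueness; a single cluster point
    in a compact set is a limit. *)
Lemma maximizer_continuous v : {for v, continuous m}.
Proof.
pose B := `|v| + 1.
have B0 : 0 <= B by rewrite addr_ge0.
have [rho rho0 mB] := m_bounded _ B0.
have near_B : \forall w \near v, `|w| <= B.
  apply: (@filterS _ _ (nbhs_filter v) _ _ _ (near_dist_le v 1 ltr01)) => w vw.
  rewrite -[w](subKr v) (le_trans (ler_normB _ _))//.
  by rewrite lerD2l.
(* The extra 1 in the radius makes [V] a neighbourhood of [m v]. *)
pose V := closed_ball (0 : 'rV[R]_J) (rho + 1).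
have VE x : V x = (`|x| <= rho + 1) :> Prop.
  rewrite /V closed_ballE ?ltr_wpDl// /closed_ball_/= sub0r normrN.
  by [].
have cV : compact V.
  apply: bounded_closed_compact; last exact: closed_ball_closed.
  exists (rho + 1); split; first exact: num_real.
  by move=> M rM x; rewrite VE => /le_trans; apply; exact: ltW.
pose F := m x @[x --> v].
have PF : ProperFilter F := fmap_proper_filter m (nbhs_pfilter v).
have FV : F V.
  apply: (@filterS _ _ (nbhs_filter v) _ _ _ near_B) => w /mB mw.
  by rewrite /= VE (le_trans mw)// lerDl.
have sub_m p : cluster F p -> p = m v.
  move=> Fp; apply: m_unique => y; rewrite leNgt; apply/negP => ylt.
  have fy : edom f y.
    by rewrite /edom/= (lt_le_trans ylt)// leey.
  have fyE := fineE_edom _ f_proper _ fy.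
  (* If the inequality fails at [y], some real [a] fits strictly in the gap. *)
  have [a [ya ap]] : exists a, phi y < a /\ (a%:E < f p + (dot v (y - p))%:E)%E.
    move: ylt; rewrite fyE; case: (f p) => [r|_|//]; last first.
      by exists (phi y + 1); rewrite ltrDl ltry.
    rewrite -EFinD lte_fin => yr.
    by exists ((phi y + (r + dot v (y - p))) / 2); rewrite lte_fin !midf_lt.
  have cd : continuous (fun x => dot v (y - x)).
    move=> x; rewrite /continuous_at.
    under eq_fun do rewrite dotBr.
    rewrite dotBr; apply: (@cvgB _ _ _ _ (nbhs_filter x)); first exact: cvg_cst.
    exact: continuous_dot.
  have [W Wp fW] := lsc_addr _ _ f_lsc cd _ _ ap.
  pose K := J%:R * (`|y| + rho) + 1.
  have K0 : 0 < K by rewrite ltr_wpDl// mulr_ge0// addr_ge0.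
  (* [K] dominates [J |y - m w|], so replacing [v] by [w] within distance [d] costs at most the gap
     [a - phi y]. *)
  pose d := (a - phi y) / K.
  have d0 : 0 < d by rewrite divr_gt0// subr_gt0.
  have Fd : F (m @` [set w | `|v - w| <= d /\ `|w| <= B]).
    apply: (@filterS2 _ _ (nbhs_filter v) _ _ _ _ (near_dist_le v d d0) near_B).
    by move=> w vw wB; exists w.
  have [z [[w [vw wB] <-] Wm]] := Fp _ _ Fd Wp.
  have fm := subdiff_edom _ f_proper _ _ (m_subdiff w).
  have := fW _ Wm; rewrite (fineE_edom _ f_proper _ fm) -EFinD lte_fin.
  have := subdiff_fine _ f_proper _ _ _ fm fy (m_subdiff w).
  have dist : dot v (y - m w) - dot w (y - m w) <= a - phi y.
    rewrite -dotBl (le_trans (ler_norm _))// (le_trans (dot_le_norm _ _))//.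
    rewrite (@le_trans _ _ (K * d))//; last first.
      by rewrite /d mulrCA divff ?mulr1// gt_eqF.
    rewrite mulrAC ler_pM//.
    rewrite (@le_trans _ _ (J%:R * (`|y| + rho)))//; last by rewrite lerDl.
    rewrite ler_wpM2l// (le_trans (ler_normB _ _))// lerD2l.
    exact: mB.
  move: dist; rewrite /phi/=.
  by move: (dot v _) (dot w _) (fine _) => b1 b2 b3; lra.
have cF : cluster F = [set m v].
  apply/seteqP; split=> [p /sub_m//|_ ->].
  by have [p [_ Fp]] := cV _ PF FV; rewrite -(sub_m _ Fp).
have nV : nbhs (m v) V.
  apply/nbhs_ballP; exists 1 => //= x; rewrite -ball_normE/= VE => mx.
  rewrite -[x](subKr (m v)) (le_trans (ler_normB _ _))//.
  by rewrite lerD ?(ltW mx)// mB// /B lerDl.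
exact: (compact_cluster_set1 (@norm_hausdorff _ _) cV nV PF FV cF).
Qed.

(** The increment of [psi] from [v] to [v + h] lies between [<m v, h>] and [<m (v + h), h>], whose
    difference is [o(|h|)] by continuity of [m]. *)
Lemma gradient_fenchel v : gradient (fenchel f) v = m v.
Proof.
pose l : {linear 'rV[R]_J -> R} :=
  HB.pack (dot (m v)) (GRing.isLinear.Build _ _ _ _ _ (linear_dot (m v))).
have dl : 'd psi v = l :> ('rV[R]_J -> R).
  apply: diff_unique; first exact: continuous_dot.
  apply/eqaddoP => e e0.
  have JK : 0 < J%:R + 1 :> R by rewrite ltr_wpDl.
  have e1 : 0 < e / (J%:R + 1) by rewrite divr_gt0.
  have cm : \forall w \near v, `|m v - m w| <= e / (J%:R + 1).
    apply: (@cvgr_dist_le _ _ _ _ (nbhs_filter v) _ _ _ _ e1).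
    exact: maximizer_continuous.
  have cs : h + v @[h --> (0 : 'rV[R]_J)] --> v.
    rewrite -[X in _ --> X]add0r.
    by apply: (@cvgD _ _ _ _ (nbhs_filter _)); [exact: cvg_id|exact: cvg_cst].
  apply: (@filterS _ _ (nbhs_filter _) _ _ _ (cs _ cm)) => h /= mh.
  have hE : h + v - v = h by rewrite addrK.
  have := conjugate_ineq v (h + v); rewrite hE => lo.
  have hN : v - (h + v) = - h by rewrite opprD addrCA subrr addr0.
  have := conjugate_ineq (h + v) v; rewrite hN dotNr => hi.
  have dm : `|dot (m v - m (h + v)) h| <= e * `|h|.
    rewrite (le_trans (dot_le_norm _ _))// ler_wpM2r//.
    rewrite (@le_trans _ _ ((J%:R + 1) * (e / (J%:R + 1))))//.
      by rewrite ler_pM// lerDl.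
    by rewrite mulrCA divff ?mulr1// gt_eqF.
  change (`|psi (h + v) - (psi v + dot (m v) h)| <= e * `|h|).
  move: dm; rewrite dotBl !ler_norml; move: lo hi.
  by move: (psi _) (psi _) (dot _ _) (dot _ _) => p q r s; lra.
apply/rowP => i; rewrite mxE -[in RHS](dot_delta (m v)).
exact: (congr1 (fun h => h (delta_mx ord0 i)) dl).
Qed.

End Conjugate.

(** * The conjugate of [neg_reflect f C] and the farthest distance *)

Section FarthestDistance.
Context {R : realType} {J : nat}.
Implicit Types (x y v w : 'rV[R]_J) (t : R).

Lemma ereal_sup_EFinD {T : Type} (C : set T) (h : T -> R) (k : R) :
  C !=set0 ->
  ereal_sup [set (h c + k)%:E | c in C] =
    (ereal_sup [set (h c)%:E | c in C] + k%:E)%E.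
Proof.
move=> [c0 Cc0]; apply/eqP; rewrite eq_le; apply/andP; split.
  apply: ge_ereal_sup => _ [c Cc <-]; rewrite EFinD leeD2r//.
  by apply: ereal_sup_ubound; exists c.
rewrite -leeBrDr//; apply: ge_ereal_sup => _ [c Cc <-]; rewrite leeBrDr//.
by rewrite -EFinD; apply: ereal_sup_ubound; exists c.
Qed.

(** Substitute [x = - c]; points outside [-C] contribute [-oo] to the supremum. *)
Lemma fenchel_neg_reflect (f : 'rV[R]_J -> \bar R) (C : set 'rV[R]_J) v :
  (forall c, C c -> f c \is a fin_num) ->
  fenchel (neg_reflect f C) v =
    ereal_sup [set (fine (f c) - dot v c)%:E | c in C].
Proof.
move=> fC; apply/eqP; rewrite eq_le; apply/andP; split.
  apply: ge_ereal_sup => _ [x _ <-]; rewrite /neg_reflect.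
  case: ifPn => [|_]; last by rewrite leNye.
  rewrite inE => -[c Cc <-]; rewrite opprK oppeK dotNr.
  apply: ereal_sup_ubound; exists c => //.
  by rewrite -[in RHS](fineK (fC _ Cc)) -EFinD addrC.
apply: ge_ereal_sup => _ [c Cc <-]; apply: ereal_sup_ubound.
exists (- c) => //; rewrite /neg_reflect ifT; last by rewrite inE; exists c.
by rewrite opprK oppeK dotNr -[in LHS](fineK (fC _ Cc)) -EFinD addrC.
Qed.

Lemma econvex_fenchel (h : 'rV[R]_J -> \bar R) : econvex (fenchel h).
Proof.
move=> v w t /andP[t0 t1]; have t1' : 0 < 1 - t by rewrite subr_gt0.
apply: ge_ereal_sup => _ [x _ <-].
apply: (@le_trans _ _ (t%:E * ((dot v x)%:E - h x) +
    (1 - t)%:E * ((dot w x)%:E - h x))%E); last first.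
  by apply: leeD; (apply: lee_wpmul2l; first by rewrite lee_fin ltW);
    apply: ereal_sup_ubound; exists x.
(* For [h x = +oo] the left side is [-oo]; for [h x = -oo] the right side is [+oo]. *)
case: (h x) => [r| |] /=.
- rewrite -!EFinB -!EFinM -EFinD lee_fin dotDl !dotZl; lra.
- by rewrite leNye.
- by rewrite !addey// !gt0_muley ?lte_fin// leey.
Qed.

Lemma econvexD (h k : 'rV[R]_J -> \bar R) : econvex h -> econvex k ->
    (forall x, h x \is a fin_num) -> (forall x, k x \is a fin_num) ->
  econvex (fun x => h x + k x)%E.
Proof.
move=> ch ck fh fk x y t t01.
apply: le_trans (leeD (ch x y t t01) (ck x y t t01)) _.
rewrite -(fineK (fh x)) -(fineK (fh y)) -(fineK (fk x)) -(fineK (fk y)).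
by rewrite -!EFinD lee_fin; lra.
Qed.

(** A uniform constant on each ball, in the sup norm: stronger than a local Lipschitz condition and
    stable under sums without intersecting neighbourhoods. *)
Definition lipschitz_on_bounded (p : 'rV[R]_J -> R) := forall B : R, 0 <= B ->
  exists2 L : R, 0 <= L &
    forall v w, `|v| <= B -> `|w| <= B -> `|p v - p w| <= L * `|v - w|.

Lemma lipschitz_on_boundedD p q : lipschitz_on_bounded p ->
  lipschitz_on_bounded q -> lipschitz_on_bounded (p \+ q).
Proof.
move=> lp lq B B0; have [L L0 pL] := lp B B0; have [M M0 qM] := lq B B0.
exists (L + M); first exact: addr_ge0.
move=> v w vB wB; rewrite /= opprD addrACA mulrDl (le_trans (ler_normD _ _))//.
by rewrite lerD ?pL ?qM.
Qed.

Lemma lipschitz_on_bounded_locally p : lipschitz_on_bounded p ->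
  locally_lipschitz_on Num.norm setT p.
Proof.
move=> lp x _; have [|L L0 pL] := lp (`|x| + 1); first by rewrite addr_ge0.
exists L; exists [set y | `|x - y| <= 1].
  exact: near_dist_le.
have xB y : `|x - y| <= 1 -> `|y| <= `|x| + 1.
  move=> xy; rewrite -[y](subKr x) (le_trans (ler_normB _ _))//.
  by rewrite lerD2l.
move=> y z [_ /xB yB] [_ /xB zB]; rewrite (le_trans (pL _ _ yB zB))//.
by rewrite ler_wpM2l// norm_le_enorm.
Qed.

Lemma lipschitz_on_bounded_continuous p : lipschitz_on_bounded p ->
  continuous p.
Proof.
move=> /lipschitz_on_bounded_locally lp x.
by apply: lipschitz_continuous_at lp _; rewrite interiorT.
Qed.

(** The neighbourhood [W] for [p] is pulled back along [g]. Lipschitz bounds on [A] give continuity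
    relative to [A] only, hence the separate continuity hypothesis. *)
Lemma locally_lipschitz_comp A (g : 'rV[R]_J -> 'rV[R]_J) (p : 'rV[R]_J -> R) :
    locally_lipschitz_on enorm A g ->
    (forall x, A x -> {for x, continuous g}) ->
    locally_lipschitz_on Num.norm setT p ->
  locally_lipschitz_on Num.norm A (p \o g).
Proof.
move=> lg cg lp x Ax; have [L [V Vx gV]] := lg x Ax.
have [M [W Wx pW]] := lp (g x) I.
exists (`|M| * L); exists (V `&` g @^-1` W).
  by apply: (@filterI _ _ (nbhs_filter x)) => //; exact: cg.
move=> y z [Ay [Vy Wy]] [Az [Vz Wz]].
rewrite (le_trans (pW _ _ (conj I Wy) (conj I Wz)))//.
rewrite (@le_trans _ _ (`|M| * enorm (g y - g z)))//.
  by rewrite ler_wpM2r ?enorm_ge0// ler_norm.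
by rewrite -mulrA ler_wpM2l// gV.
Qed.

Variables (f : 'rV[R]_J -> \bar R) (C : set 'rV[R]_J).
Variables (b r : R).
Hypothesis C_nonempty : C !=set0.
Hypothesis f_fin : forall c, C c -> f c \is a fin_num.
Hypothesis f_le : forall c, C c -> fine (f c) <= b.
Hypothesis C_bounded : forall c, C c -> `|c| <= r.

Let phi := fine \o f.
Let chi := fine \o fenchel (neg_reflect f C).

Let has_sup_affine v : has_sup [set phi c - dot v c | c in C].
Proof.
split; first exact: image_nonempty.
exists (b + J%:R * `|v| * r) => _ [c Cc <-].
rewrite lerD ?f_le// (le_trans (ler_norm _))// normrN.
by rewrite (le_trans (dot_le_norm _ _))// ler_wpM2l ?mulr_ge0// C_bounded.
Qed.

(** The affine values over [C] are bounded above, so the extended supremum is a real one. *)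
Lemma conj_neg_reflectE v : fenchel (neg_reflect f C) v = (chi v)%:E.
Proof.
suff supE : fenchel (neg_reflect f C) v =
    (sup [set phi c - dot v c | c in C])%:E by rewrite /chi/= supE.
rewrite fenchel_neg_reflect// -ereal_sup_EFin.
- by rewrite image_comp.
- exact: (has_sup_affine v).2.
- exact: (has_sup_affine v).1.
Qed.

Lemma conj_neg_reflect_ge v c : C c -> phi c - dot v c <= chi v.
Proof.
move=> Cc; rewrite -lee_fin -conj_neg_reflectE fenchel_neg_reflect//.
by apply: ereal_sup_ubound; exists c.
Qed.

Lemma conj_neg_reflect_le v a :
  (forall c, C c -> phi c - dot v c <= a) -> chi v <= a.
Proof.
move=> le_a; rewrite -lee_fin -conj_neg_reflectE fenchel_neg_reflect//.
by apply: ge_ereal_sup => _ [c Cc <-]; rewrite lee_fin le_a.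
Qed.

(** Each affine function in the supremum has slope [- c] with [|c| <= r], so [J r] serves on all of
    space. *)
Lemma conj_neg_reflect_lipschitz : lipschitz_on_bounded chi.
Proof.
have [c0 Cc0] := C_nonempty.
have r0 : 0 <= r := le_trans (normr_ge0 _) (C_bounded _ Cc0).
move=> B B0; exists (J%:R * r); first by rewrite mulr_ge0.
have le_chi v w : chi v <= chi w + J%:R * r * `|v - w|.
  apply: conj_neg_reflect_le => c Cc.
  have -> : phi c - dot v c = (phi c - dot w c) + dot (v - w) (- c).
    by rewrite dotBl !dotNr; lra.
  apply: lerD; first exact: conj_neg_reflect_ge.
  rewrite (le_trans (ler_norm _))// (le_trans (dot_le_norm _ _))// normrN.
  by rewrite mulrAC ler_wpM2r// ler_wpM2l// C_bounded.
move=> v w _ _; have := le_chi v w; have := le_chi w v.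
by rewrite (distrC w) ler_norml => ? ?; lra.
Qed.

(** [D(c, y)] is [f c - <grad f y, c>] plus a term independent of [c], which leaves the supremum. *)
Lemma left_farthestE y : f y \is a fin_num -> idom f y ->
  left_farthest f C y =
    (fenchel (neg_reflect f C) (gradient f y) +
      (dot (gradient f y) y - phi y)%:E)%E.
Proof.
move=> fy Uy; rewrite fenchel_neg_reflect// -ereal_sup_EFinD//.
congr ereal_sup; apply/seteqP; split=> _ [c Cc <-]; exists c => //;
  rewrite /bregman mem_set// -[f c]fineK ?f_fin// -[f y]fineK//;
  rewrite -!EFinB dotBr; congr EFin; rewrite /phi/=;
  by move: (dot _ c) (dot _ y) => p q; lra.
Qed.

End FarthestDistance.

(** * Continuously differentiable maps are locally Lipschitz *)

Section ContinuouslyDifferentiable.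
Context {R : realType} {J : nat}.
Variable G : 'rV[R]_J -> 'rV[R]_J.
Implicit Types (x y z w : 'rV[R]_J) (t : R).

Lemma is_derive_line z w t i : differentiable G (z + t *: w) ->
  is_derive t 1 (fun s => G (z + s *: w) ord0 i)
    ((w *m 'J G (z + t *: w)) ord0 i).
Proof.
move=> dG; have derG : derivable G (z + t *: w) w by exact: diff_derivable.
have /derivable_mxP/(_ ord0 i) derGi := derG.
have -> : (w *m 'J G (z + t *: w)) ord0 i =
    'D_w (fun x => G x ord0 i) (z + t *: w).
  have /(congr1 (fun M : 'rV_J => M ord0 i)) := deriveEjacobian w dG.
  by rewrite derive_mx// mxE => <-.
(* The quotient along the line at [t] and the quotient of the coordinate of [G] in direction [w] are
   the same function of [s]. *)
pose q1 s := s^-1 *: (((fun x => G x ord0 i) \o shift (z + t *: w)) (s *: w) -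
  G (z + t *: w) ord0 i).
pose q2 s := s^-1 *: (((fun s => G (z + s *: w) ord0 i) \o shift t) (s *: 1) -
  G (z + t *: w) ord0 i).
have qE : q2 = q1.
  apply/funext => s; rewrite /q1 /q2 /=; congr (_ *: (G _ _ _ - _)).
  by rewrite [s *: 1]mulr1 scalerDl addrCA.
apply: DeriveDef.
  by change (cvg (q2 s @[s --> 0^'])); rewrite qE.
by change (lim (q2 s @[s --> 0^']) = lim (q1 s @[s --> 0^'])); rewrite qE.
Qed.

(** The Jacobian is bounded by [c] on a ball inside [A]. Balls are convex, so the mean value theorem
    applies to each coordinate along the segment from [z] to [y]. *)
Lemma locally_lipschitz_C1 A : open A ->
    (forall x, A x -> differentiable G x) ->
    {within A, continuous (fun x => 'J G x)} ->
  locally_lipschitz_on enorm A G.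
Proof.
move=> oA dG; rewrite continuous_open_subspace// => cJ x Ax.
have cJx : 'J G y @[y --> x] --> 'J G x by apply: cJ; rewrite inE.
pose c := `|'J G x| + 1.
have c0 : 0 <= c by rewrite addr_ge0.
have near_J : \forall y \near x, `|'J G y| <= c.
  apply: (@filterS _ _ (nbhs_filter x) _ _ _
    (@cvgr_dist_le _ _ _ _ (nbhs_filter x) _ _ cJx _ ltr01)) => y xy.
  rewrite -['J G y](subKr ('J G x)) (le_trans (ler_normB _ _))//.
  by rewrite lerD2l.
have near_A : nbhs x A by exact: open_nbhs_nbhs.
have /nbhs_ballP[e /= e0 eP] : \forall y \near x, A y /\ `|'J G y| <= c.
  exact: (@filterI _ _ (nbhs_filter x)).
(* One factor [J] comes from [enorm <= J |.|], the other from the [J] summands of a row times the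
   Jacobian. *)
exists (J%:R * (J%:R * c)); exists (ball x e); first exact: nbhsx_ballx.
move=> y z [_ xy] [_ xz].
have seg t : t \in `[0, 1]%R -> A (z + t *: (y - z)) /\
    `|'J G (z + t *: (y - z))| <= c.
  rewrite in_itv/= => /andP[t0 t1]; apply: eP.
  move: xy xz; rewrite -!ball_normE/= => xy xz.
  have -> : x - (z + t *: (y - z)) = t *: (x - y) + (1 - t) *: (x - z).
    by apply/rowP => i; rewrite !mxE; ring.
  rewrite (le_lt_trans (ler_normD _ _))// !normrZ ger0_norm//.
  rewrite ger0_norm ?subr_ge0//.
  have -> : e = t * e + (1 - t) * e by ring.
  (* At [t = 0] strictness comes from [z]; otherwise it comes from [y], whose weight [t] is
     positive. *)
  have [->|tn0] := eqVneq t 0; first by rewrite !mul0r !add0r subr0 !mul1r.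
  rewrite ltr_leD// ?ltr_pM2l// ?lt_neqAle ?(eq_sym 0) ?tn0//.
  by rewrite ler_wpM2l ?subr_ge0// ltW.
have coordP i : `|(G y - G z) ord0 i| <= J%:R * c * `|y - z|.
  pose h (t : R) : R := G (z + t *: (y - z)) ord0 i.
  pose dh (t : R) : R := ((y - z) *m 'J G (z + t *: (y - z))) ord0 i.
  have der t : t \in `[0, 1]%R -> is_derive t 1 h (dh t).
    by move=> /seg[At _]; apply: is_derive_line; exact: dG.
  have cont_h : {within `[0, 1], continuous h}.
    by apply: derivable_within_continuous => t /der dt; exact: ex_derive.
  have der_oo t : t \in `]0, 1[%R -> is_derive t 1 h (dh t).
    by move=> t01; apply: der; exact: subset_itv_oo_cc.
  have [t t01] := MVT_segment ler01 der_oo cont_h.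
  rewrite /h /dh scale1r scale0r addr0 subrKC subr0 mulr1 !mxE => ->.
  rewrite (le_trans (ler_norm_sum _ _ _))//.
  rewrite (@le_trans _ _ (\sum_(j < J) `|y - z| * c))//.
    apply: ler_sum => j _; rewrite normrM ler_pM// ?coord_le_norm//.
    apply: le_trans (seg _ t01).2.
    rewrite [leRHS]/Num.Def.normr/= mx_normrE.
    exact: (le_bigmax _ (fun ij => `|'J G _ ij.1 ij.2|) (j, i)).
  by rewrite sumr_const card_ord -[leLHS]mulr_natl -mulrA (mulrC c).
rewrite (le_trans (enorm_le_norm _))// -mulrA ler_wpM2l//.
rewrite (@le_trans _ _ (J%:R * c * `|y - z|))//.
  by apply: norm_le_coord => //; rewrite !mulr_ge0.
by rewrite ler_wpM2l ?mulr_ge0// norm_le_enorm.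
Qed.

End ContinuouslyDifferentiable.

(** * The maximizer map of a Legendre function and the final assembly *)

Lemma locally_lipschitz_ext {R : realType} {J : nat} (A : set 'rV[R]_J)
    (p q : 'rV[R]_J -> R) : (forall x, A x -> p x = q x) ->
  locally_lipschitz_on Num.norm A p -> locally_lipschitz_on Num.norm A q.
Proof.
move=> pq lp x /lp[L [V Vx pV]]; exists L; exists V => // y z Ay Az.
by rewrite -!pq ?pV//; [exact: Az.1|exact: Ay.1].
Qed.

(** This map will turn out to be [grad f^*]. It is bounded on balls because a maximizer cannot lie
    where [conjugate_tail] puts the value below that at [x0]. *)
Lemma legendre_maximizer {R : realType} {J : nat} (f : 'rV[R]_J -> \bar R) :
    legendre f -> one_coercive f ->
  exists m : 'rV[R]_J -> 'rV[R]_J,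
    [/\ forall v, subdiff f (m v) v, forall v, idom f (m v),
        forall x v, subdiff f x v -> x = m v &
        forall B : R, 0 <= B -> exists2 rho : R, 0 <= rho &
          forall v, `|v| <= B -> `|m v| <= rho].
Proof.
move=> [f_proper f_lsc f_convex [U0 f_diff f_blowup] f_strict] f_coercive.
have f_cont x : idom f x -> {for x, continuous (fine \o f)}.
  by move=> Ux; exact: differentiable_continuous (f_diff _ Ux).
have g_subdiff := subdiff_gradient f f_proper f_convex f_diff.
have ex_m v : exists x, subdiff f x v.
  by have [x _ fxv] := exists_subdiff _ f_proper f_coercive f_lsc v; exists x.
have [m mP] := boolp.choice ex_m.
have fm v := subdiff_edom _ f_proper _ _ (mP v).
exists m; split => //.
- move=> v.
  exact: (subdiff_idom _ _ f_proper f_convex f_cont g_subdiff f_blowup _ _ U0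
    (fm v) (mP v)).
- by move=> x v fxv; exact: (subdiff_inj _ f_proper f_convex f_strict _ _ v).
- move=> B B0; have [x0 fx0] := f_proper.1.
  have [rho rho0 rhoP] := conjugate_tail _ f_proper f_coercive _ _ fx0 B0.
  exists rho => // v vB; rewrite leNgt; apply/negP => /(rhoP _ _ vB).
  have := subdiff_fine _ f_proper _ _ _ (fm v) fx0 (mP v).
  rewrite (fineE_edom _ f_proper _ (fm v)) (fineE_edom _ f_proper _ fx0).
  rewrite -!EFinB lte_fin dotBr /=.
  by move: (dot _ _) (dot _ _) => p q; lra.
Qed.

Theorem proposition3p2 (R : realType) (J : nat)
    (f : 'rV[R]_J -> \bar R) (C : set 'rV[R]_J)
    (f_legendre : legendre f)
    (f_coercive : one_coercive f)
    (C_nonempty : C !=set0)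
    (C_bounded : exists M : R, forall x, C x -> enorm x <= M)
    (C_closed : closed C)
    (C_sub : C `<=` idom f) :
  let U := idom f in
  let F := left_farthest f C in
  let fs := fenchel f in
  let hs := fenchel (neg_reflect f C) in
  ((forall y, U y -> F y \is a fin_num) /\ {within U, continuous F}) /\
  (forall y, U y -> F y = (fs (gradient f y) + hs (gradient f y))%E) /\
  elocally_lipschitz_on setT (fun v => fs v + hs v)%E /\
  {within U, continuous (gradient f)} /\
  (locally_lipschitz_on enorm U (gradient f) -> elocally_lipschitz_on U F) /\
  (twice_continuously_differentiable_on U f ->
     locally_lipschitz_on enorm U (gradient f)) /\
  (forall v, hs v = (F (gradient fs v) - fs v)%E) /\
  elocally_lipschitz_on setT (fun v => F (gradient fs v)) /\
  econvex (fun v => F (gradient fs v)) /\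
  edom (fun v => F (gradient fs v)) = setT.
Proof.
move=> U F fs hs.
have [m [m_subdiff m_idom m_unique m_bounded]] :=
  legendre_maximizer _ f_legendre f_coercive.
have [f_proper f_lsc f_convex [_ f_diff _] _] := f_legendre.
have g_subdiff := subdiff_gradient f f_proper f_convex f_diff.
have g_cont := continuous_gradient f f_proper f_convex f_diff.
have f_fin y : U y -> f y \is a fin_num.
  by move=> /(idom_edom f) fy; rewrite (fineE_edom _ f_proper _ fy).
have [M CM] := C_bounded.
have C_norm c : C c -> `|c| <= M.
  by move=> /CM; apply: le_trans; exact: norm_le_enorm.
(* [f] is continuous on the compact set [C], so it attains a maximum there. *)
have [b Cb] : exists b : R, forall c, C c -> fine (f c) <= b.
  have cC : compact C.
    apply: bounded_closed_compact C_closed; exists M.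
    split; first exact: num_real.
    by move=> N MN c /C_norm /le_trans; apply; exact: ltW.
  have [|c0 _ c0P] := @EVT_max_rV R J (fine \o f) C C_nonempty cC.
    apply: continuous_in_subspaceT => c; rewrite inE => /C_sub Uc.
    exact: differentiable_continuous (f_diff _ Uc).
  by exists (fine (f c0)) => c Cc; apply: c0P; rewrite inE.
have C_fin c : C c -> f c \is a fin_num by move=> /C_sub; exact: f_fin.
pose psi := fine \o fs; pose chi := fine \o hs.
have fsE v : fs v = (psi v)%:E := fenchel_EFin _ _ f_proper m_subdiff v.
have hsE v : hs v = (chi v)%:E :=
  conj_neg_reflectE _ _ _ _ C_nonempty C_fin Cb C_norm v.
have psi_lip : lipschitz_on_bounded psi :=
  conjugate_lipschitz _ _ f_proper m_subdiff m_bounded.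
have chi_lip : lipschitz_on_bounded chi :=
  conj_neg_reflect_lipschitz _ _ _ _ C_nonempty C_fin Cb C_norm.
have sum_lip := lipschitz_on_boundedD _ _ psi_lip chi_lip.
have sumE v : (fs v + hs v)%E = ((psi \+ chi) v)%:E by rewrite fsE hsE.
(* The term of [left_farthestE] free of [c] is [f^*] at [grad f y], by the Fenchel-Young
   equality. *)
have FE y : U y -> F y = (fs (gradient f y) + hs (gradient f y))%E.
  move=> Uy; rewrite /F left_farthestE ?f_fin// addeC; congr (_ + _)%E.
  by rewrite -(fenchel_subdiff _ f_proper _ _ (g_subdiff _ Uy)).
have FEr y : U y -> F y = ((psi \+ chi) (gradient f y))%:E.
  by move=> Uy; rewrite FE// sumE.
have g_m v : gradient f (m v) = v.
  by apply/esym/(subdiff_eq_gradient _ f_proper f_diff).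
have gsE v : gradient fs v = m v.
  exact: (gradient_fenchel _ _ f_proper f_lsc m_subdiff m_unique m_bounded).
(* As [grad f] inverts [m], the composition formula becomes an identity on the whole space; all
   claims on [F] after [grad f^*] follow from it. *)
have Fgs : (fun v => F (gradient fs v)) = (fun v => fs v + hs v)%E.
  by apply/funext => v; rewrite gsE (FE _ (m_idom v)) g_m.
have sum_elip : elocally_lipschitz_on setT (fun v => fs v + hs v)%E.
  split=> [v _|]; first by rewrite sumE.
  apply: (locally_lipschitz_ext _ (psi \+ chi)).
    by move=> v _; rewrite [in RHS]/= sumE.
  exact: lipschitz_on_bounded_locally.
split; first split.
- by move=> y Uy; rewrite FEr.
- apply: (@subspace_eq_continuous _ _ _ (EFin \o ((psi \+ chi) \o gradient f))).
    by move=> y; rewrite inE => Uy; exact: esym (FEr _ Uy).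
  apply: continuous_in_subspaceT => y; rewrite inE => Uy.
  apply: continuous_comp; last by apply: cvg_EFin; [exact: nearW|exact: cvg_id].
  apply: continuous_comp; first exact: g_cont.
  exact: lipschitz_on_bounded_continuous.
split; first exact: FE.
split; first exact: sum_elip.
split; first by apply: continuous_in_subspaceT => y; rewrite inE; exact: g_cont.
split.
  move=> g_lip; split=> [y Uy|]; first by rewrite FEr.
  apply: (locally_lipschitz_ext _ ((psi \+ chi) \o gradient f)).
    by move=> y Uy; rewrite [in RHS]/= FEr.
  apply: locally_lipschitz_comp => //.
  exact: lipschitz_on_bounded_locally.
split.
  move=> [_ dg cJ]; apply: locally_lipschitz_C1 => //.
  exact: open_interior.
split.
  (* [fs v] may be cancelled because it is finite. *)
  move=> v; rewrite gsE (FE _ (m_idom v)) g_m [(fs v + _)%E]addeC addeK//.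
  by rewrite fsE.
split; first by rewrite Fgs.
split.
  rewrite Fgs; apply: econvexD; do ?exact: econvex_fenchel.
    by move=> v; rewrite fsE.
  by move=> v; rewrite hsE.
by rewrite Fgs; apply/seteqP; split => // v _; rewrite /edom/= sumE ltry.
Qed.
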